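(* Let $(A_\bullet)$ be an elliptic pre-complex based on Neumann conditions, with lifted complex $(\mathcal{A}_\bullet)$, and let $\mathcal{H}_N^{\alpha+1}:=\ker(\mathcal{A}_{\alpha+1},\mathcal{A}_\alpha^*,B_\alpha^* )$. Let $\tilde{\mathcal{P}}_{\alpha-1}:\Gamma(\mathbb{E}_\alpha)\to\Gamma(\mathbb{E}_\alpha)$ be the $L^2$-orthogonal projection onto $\ker(\mathcal{A}_{\alpha-1}^*|_{\ker B_{\alpha-1}^*})$, so that $\mathrm{Id}-\tilde{\mathcal{P}}_{\alpha-1}$ is the projection onto $\mathrm{Im}(\mathcal{A}_{\alpha-1})$. Then, for every $\alpha$, $$\mathcal{A}_\alpha=A_\alpha\tilde{\mathcal{P}}_{\alpha-1}\qquad\text{and}\qquad \mathcal{A}_\alpha^*=\tilde{\mathcal{P}}_{\alpha-1}A_\alpha^*\ \text{ on }\ker B_\alpha^*,$$ and $$\mathcal{H}_N^{\alpha+1}=\ker(A_{\alpha+1},\tilde{\mathcal{P}}_{\alpha-1}A_\alpha^*,B_\alpha^* ).$$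
   Context: Setting. $M$ is a compact Riemannian manifold with smooth boundary $\partial M$; $\mathbb{E}_\alpha\to M$ and $\mathbb{J}_\alpha\to\partial M$, $\alpha\in\mathbb{N}_0$, are Riemannian vector bundles; $\Gamma(\cdot)$ denotes smooth sections (Fréchet topology); $\langle\cdot,\cdot\rangle$ denotes $L^2$ products over $M$ or $\partial M$. One is given differential operators $A_\alpha:\Gamma(\mathbb{E}_\alpha)\to\Gamma(\mathbb{E}_{\alpha+1})$ of order $m_\alpha=\mathrm{ord}(A_\alpha)$ (orders may differ with $\alpha$), differential operators $A_\alpha^*:\Gamma(\mathbb{E}_{\alpha+1})\to\Gamma(\mathbb{E}_\alpha)$, and boundary operators $B_\alpha:\Gamma(\mathbb{E}_\alpha)\to\Gamma(\mathbb{J}_\alpha)$, $B_\alpha^*:\Gamma(\mathbb{E}_{\alpha+1})\to\Gamma(\mathbb{J}_\alpha)$ (the symbol $B_\alpha^*$ is notation, not the adjoint of $B_\alpha$) satisfying Green's formulae $$\langle A_\alpha\psi,\eta\rangle_{L^2(M)}=\langle\psi,A_\alpha^*\eta\rangle_{L^2(M)}+\langle B_\alpha\psi,B_\alpha^*\eta\rangle_{L^2(\partial M)} .$$ All objects with negative index are zero, except that $\tilde{\mathcal{P}}_{-1}=\mathrm{Id}$. A boundary operator $B$ is a normal system of trace operators if $B=\bigoplus_{j=0}^rB_j$ with each $B_j$ a differential boundary operator of order $j$ whose leading normal-derivative coefficient at the boundary is a surjective bundle morphism. A system $P_1\oplus P_2\oplus B$ with $P_i$ interior differential operators of order $m_i$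 and $B=\bigoplus_{j=0}^rB_j$ is overdetermined elliptic if its (multi-order) interior principal symbol is injective at nonzero covectors and the Lopatinskii–Shapiro condition holds in the injective sense. $(A_\bullet)$ is an elliptic pre-complex based on Neumann conditions if for every $\alpha$: (a) $B_\alpha$, $B_\alpha^*$ are normal systems of trace operators; (b) $\mathrm{ord}(A_{\alpha+1}A_\alpha)\le\mathrm{ord}(A_\alpha)$; (c) $A_\alpha\oplus A_{\alpha-1}^*\oplus B_{\alpha-1}^*$ is overdetermined elliptic. Lifted complex. $(\mathcal{A}_\bullet)$ is the unique sequence of continuous linear maps $\mathcal{A}_\alpha:\Gamma(\mathbb{E}_\alpha)\to\Gamma(\mathbb{E}_{\alpha+1})$, $\mathcal{A}_{-1}=0$, $\mathcal{A}_0=A_0$, with $\mathcal{A}_{\alpha+1}\mathcal{A}_\alpha=0$ identically and $\mathcal{A}_{\alpha+1}=A_{\alpha+1}$ on $\ker(\mathcal{A}_\alpha^*|_{\ker B_\alpha^*})$. Here $\mathcal{A}_\alpha^*$ is the formal adjoint: the continuous linear map with $\langle\mathcal{A}_\alpha\psi,\eta\rangle=\langle\psi,\mathcal{A}_\alpha^*\eta\rangle+\langle B_\alpha\psi,B_\alpha^*\eta\rangle$ for all smooth $\psi,\eta$. One has the $L^2$-orthogonal direct sum $\Gamma(\mathbb{E}_\alpha)=\mathrm{Im}(\mathcal{A}_{\alpha-1})\oplus\ker(\mathcal{A}_{\alpha-1}^*|_{\ker B_{\alpha-1}^*})$, which defines $\tilde{\mathcal P}_{\alpha-1}$. $\ker(P,Q,\dots)$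 is the intersection of kernels. *)

(* Defs.v *)
From HB Require Import structures.
From mathcomp Require Import all_boot all_order all_algebra.
From mathcomp Require Import all_classical all_reals all_analysis.
From mathcomp.real_closed Require Import complex.

Set Implicit Arguments.
Unset Strict Implicit.
Unset Printing Implicit Defensive.

Import Order.TTheory GRing.Theory Num.Theory numFieldNormedType.Exports.
Local Open Scope classical_set_scope.
Local Open Scope ring_scope.

Fixpoint Ck (R : realType) (n k : nat) (f : 'rV[R]_n.+1 -> R) : Prop :=
  continuous f /\
  if k is k'.+1 then
    forall i, (forall y, derivable f y (delta_mx 0 i)) /\
      Ck k' (fun y => 'D_(delta_mx 0 i) f y)
  else True.

Definition smooth (R : realType) (n : nat) (f : 'rV[R]_n.+1 -> R) : Prop :=
  forall k, Ck k f.

(* Smoothness on an arbitrary subset: local existence of smooth extensions. *)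
Definition smooth_on (R : realType) (n : nat) (D : set 'rV[R]_n.+1)
    (f : 'rV[R]_n.+1 -> R) : Prop :=
  forall y, D y -> exists g, smooth g /\ \forall z \near y, D z -> f z = g z.

(* The difference quotient is one-sided so that it also makes sense at the
   boundary of the half-space {y_0 >= 0}; at an interior point, and for a
   function which extends smoothly, it is the usual partial derivative. *)
Definition partial (R : realType) (n : nat) (f : 'rV[R]_n.+1 -> R)
    (i : 'I_n.+1) (y : 'rV[R]_n.+1) : R :=
  lim ((fun t : R => t^-1 * (f (y + t *: delta_mx 0 i) - f y)) @ 0^'+).

(* Lebesgue integral over R^n of a nonnegative Borel function, as an iterated
   integral (Tonelli). *)
Fixpoint lebesgue_int (R : realType) (n : nat) :
    ('rV[R]_n -> \bar R) -> \bar R :=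
  match n with
  | 0 => fun f => f 0
  | n'.+1 => fun f => integral lebesgue_measure [set: R] (fun x =>
      lebesgue_int (fun y : 'rV[R]_n' => f (row_mx (x%:M : 'M[R]_1) y)))
  end.

(* Smooth compact manifold with (possibly empty) boundary, of dimension n.+1,
   with charts onto relatively open subsets of {y_0 >= 0}. *)
Record mfd (R : realType) (n : nat) := Mfd {
  mpt :> ptopologicalType;
  mhausdorff : hausdorff_space mpt;
  mcompact : compact [set: mpt];
  mchart : Type;
  cdom : mchart -> set mpt;
  cmap : mchart -> mpt -> 'rV[R]_n.+1;
  cinv : mchart -> 'rV[R]_n.+1 -> mpt;
  cdom_open : forall c, open (cdom c);
  cdom_cover : forall x, exists c, cdom c x;
  cmap_image : forall c, exists2 W : set 'rV[R]_n.+1,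
    open W & cmap c @` cdom c = W `&` [set y | 0 <= y 0 0];
  cmapK : forall c x, cdom c x -> cinv c (cmap c x) = x;
  cmap_continuous : forall c, {within cdom c, continuous (cmap c)};
  cinv_continuous : forall c,
    {within cmap c @` cdom c, continuous (cinv c)};
  cmap_smooth : forall c c' a,
    smooth_on (cmap c @` (cdom c `&` cdom c'))
      (fun y => cmap c' (cinv c y) 0 a) }.

(* For D open in M, or open in the boundary of M. *)
Definition smooth_fun (R : realType) (n : nat) (M : mfd R n) (D : set M)
    (f : M -> R) : Prop :=
  forall c : mchart M,
    smooth_on (cmap c @` (D `&` cdom c)) (f \o cinv (m := M) c).

Definition bd (R : realType) (n : nat) (M : mfd R n) : set M :=
  [set x | exists2 c : mchart M, cdom c x & cmap c x 0 0 = 0].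
Arguments bd {R n} M.

(* The transition c -> c' has Jacobian (a, b) |-> d(y'_b)/d(y_a). *)
Definition transition_jac (R : realType) (n : nat) (M : mfd R n)
    (c c' : mchart M) (x : M) : 'M[R]_n.+1 :=
  \matrix_(a, b) partial (fun y => cmap c' (cinv c y) 0 b) a (cmap c x).

(* gram c x is the Gram matrix at x of the coordinate frame of the chart c.  The
   two measures are determined by their expressions in charts; that of the
   boundary is the volume of the metric induced on it, and boundary integrals
   are taken over the subset bd M of M. *)
Record riem_mfd (R : realType) (n : nat) := RiemMfd {
  rmfd :> mfd R n;
  gram : mchart rmfd -> rmfd -> 'M[R]_n.+1;
  gram_smooth : forall c a b, smooth_fun (cdom c) (fun x => gram c x a b);
  gram_sym : forall c x, cdom c x -> (gram c x)^T = gram c x;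
  gram_pos : forall c x (v : 'rV[R]_n.+1), cdom c x -> v != 0 ->
    0 < (v *m gram c x *m v^T) 0 0;
  gram_transition : forall c c' x, cdom c x -> cdom c' x ->
    gram c x = transition_jac c c' x *m gram c' x *m (transition_jac c c' x)^T;
  vol : {finite_measure set (g_sigma_algebraType (@open rmfd)) -> \bar R};
  vol_chart : forall c (D : set (g_sigma_algebraType (@open rmfd))),
    measurable D -> D `<=` cdom c ->
    vol D = lebesgue_int (fun y : 'rV[R]_n.+1 =>
      (\1_(cmap c @` D) y * Num.sqrt (\det (gram c (cinv c y))))%:E);
  bvol : {finite_measure set (g_sigma_algebraType (@open rmfd)) -> \bar R};
  bvol_chart : forall c (D : set (g_sigma_algebraType (@open rmfd))),
    measurable D -> D `<=` cdom c `&` bd rmfd ->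
    bvol D = lebesgue_int (fun y : 'rV[R]_n =>
      let y0 : 'rV[R]_n.+1 := row_mx (0 : 'M[R]_1) y in
      (\1_(cmap c @` D) y0 *
        Num.sqrt (\det (row' ord0 (col' ord0 (gram c (cinv c y0))))))%:E) }.

(* Riemannian vector bundle over a subset S of M, used for S = M and for
   S = bd M.  Nothing is required of the fibres outside of S. *)
Record vbundle (R : realType) (n : nat) (M : mfd R n) (S : set M) := VBundle {
  fib : M -> vectType R;
  ftriv : Type;
  fdom : ftriv -> set M;
  frank : ftriv -> nat;
  frame : forall i x, (frank i).-tuple (fib x);
  fdom_open : forall i, open (fdom i);
  fdom_cover : forall x, S x -> exists i, fdom i x;
  frame_basis : forall i x, S x -> fdom i x -> basis_of fullv (frame i x);
  frame_smooth : forall i j k l, smooth_fun (S `&` (fdom i `&` fdom j))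
    (fun x => coord (frame i x) k (tnth (frame j x) l));
  fmetric : forall x, fib x -> fib x -> R;
  fmetric_sym : forall x (u v : fib x), S x -> fmetric u v = fmetric v u;
  fmetric_linear : forall x (a : R) (u v w : fib x), S x ->
    fmetric (a *: u + v) w = a * fmetric u w + fmetric v w;
  fmetric_pos : forall x (v : fib x), S x -> v != 0 -> 0 < fmetric v v;
  fmetric_smooth : forall i k l, smooth_fun (S `&` fdom i)
    (fun x => fmetric (tnth (frame i x) k) (tnth (frame i x) l)) }.

Definition smooth_section (R : realType) (n : nat) (M : mfd R n) (S : set M)
    (E : vbundle S) (psi : forall x, fib E x) : Prop :=
  forall (i : ftriv E) k,
    smooth_fun (S `&` fdom i) (fun x => coord (frame i x) k (psi x)).

(* A section over S is a function on M set to 0 outside of S, so that sections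
   over S are equal as soon as they agree on S. *)
Record Gamma (R : realType) (n : nat) (M : mfd R n) (S : set M)
    (E : vbundle S) := MkGamma {
  gfun :> forall x, fib E x;
  gfun_smooth : smooth_section gfun;
  gfun_out : forall x, ~ S x -> gfun x = 0 }.

Section SmoothClosure.
Context {R : realType} {n : nat}.
Implicit Types (f h : 'rV[R]_n.+1 -> R).

Lemma Ck_cst k (a : R) : Ck k (fun _ : 'rV[R]_n.+1 => a).
Proof.
elim: k a => [|k IH] a /=; first by split=> //; exact: cst_continuous.
split; first exact: cst_continuous.
move=> i; split; first by move=> y; exact: derivable_cst.
suff -> : 'D_(delta_mx 0 i) (fun _ : 'rV[R]_n.+1 => a) = (fun=> 0) by exact: IH.
by apply/funext => y; rewrite derive_cst.
Qed.

Lemma CkW k f : Ck k.+1 f -> Ck k f.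
Proof.
elim: k f => [|k IH] f [cf df]; split=> // i.
have [d1 d2] := df i; split=> //; exact: IH.
Qed.

Lemma CkD k f h : Ck k f -> Ck k h -> Ck k (fun y => f y + h y).
Proof.
elim: k f h => [|k IH] f h [cf df] [ch dh]; split=> //;
  try by move=> y; exact: cvgD (cf y) (ch y).
move=> i; have [d1 d2] := df i; have [e1 e2] := dh i; split.
  by move=> y; apply: derivableD.
suff -> : 'D_(delta_mx 0 i) (fun y => f y + h y) =
  (fun y => 'D_(delta_mx 0 i) f y + 'D_(delta_mx 0 i) h y) by exact: IH.
by apply/funext => y; rewrite -deriveD.
Qed.

Lemma CkM k f h : Ck k f -> Ck k h -> Ck k (fun y => f y * h y).
Proof.
elim: k f h => [|k IH] f h Ckf Ckh; have [cf df] := Ckf; have [ch dh] := Ckh;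
  split=> //; try by move=> y; exact: cvgM (cf y) (ch y).
move=> i; have [d1 d2] := df i; have [e1 e2] := dh i; split.
  by move=> y; apply: derivableM.
suff -> : 'D_(delta_mx 0 i) (fun y => f y * h y) =
    (fun y => f y * 'D_(delta_mx 0 i) h y + h y * 'D_(delta_mx 0 i) f y).
  by apply: CkD; apply: IH => //; apply: CkW.
by apply/funext => y; rewrite -deriveM.
Qed.

Lemma smooth_on_cst D (a : R) : smooth_on D (fun _ : 'rV[R]_n.+1 => a).
Proof.
move=> y _; exists (fun=> a); split; first by move=> k; exact: Ck_cst.
by near=> z.
Unshelve. all: by end_near. Qed.

Lemma smooth_onD D f h :
  smooth_on D f -> smooth_on D h -> smooth_on D (fun y => f y + h y).
Proof.
move=> sf sh y Dy; have [f' [sf' ef]] := sf y Dy.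
have [h' [sh' eh]] := sh y Dy; exists (fun y => f' y + h' y); split.
  by move=> k; apply: CkD.
by apply: filterS2 ef eh => z ef eh Dz; rewrite ef ?eh.
Qed.

Lemma smooth_onM D f h :
  smooth_on D f -> smooth_on D h -> smooth_on D (fun y => f y * h y).
Proof.
move=> sf sh y Dy; have [f' [sf' ef]] := sf y Dy.
have [h' [sh' eh]] := sh y Dy; exists (fun y => f' y * h' y); split.
  by move=> k; apply: CkM.
by apply: filterS2 ef eh => z ef eh Dz; rewrite ef ?eh.
Qed.

Lemma smooth_onW D D' f : D' `<=` D -> smooth_on D f -> smooth_on D' f.
Proof.
move=> DD' sf y Dy; have [f' [sf' ef]] := sf y (DD' _ Dy).
by exists f'; split=> //; apply: filterS ef => z ef /DD'.
Qed.

Lemma smooth_funW (M : mfd R n) (D D' : set M) (f : M -> R) :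
  D' `<=` D -> smooth_fun D f -> smooth_fun D' f.
Proof.
move=> DD' sf c; apply: smooth_onW (sf c).
by apply: image_subset; apply: setSI.
Qed.

End SmoothClosure.

HB.instance Definition _ (R : realType) (n : nat) (M : mfd R n) (S : set M)
  (E : vbundle S) := gen_eqMixin (Gamma E).
HB.instance Definition _ (R : realType) (n : nat) (M : mfd R n) (S : set M)
  (E : vbundle S) := gen_choiceMixin (Gamma E).

Section SectionModule.
Context {R : realType} {n : nat} {M : mfd R n} {S : set M} {E : vbundle S}.
Implicit Types psi eta : Gamma E.

Lemma gamma_eqP psi eta : (forall x, psi x = eta x) -> psi = eta.
Proof.
case: psi eta => [f sf of_] [h sh oh] /= e.
have e' : f = h by apply/functional_extensionality_dep.
by subst h; congr MkGamma; exact: Prop_irrelevance.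
Qed.

Fact gamma0_smooth : smooth_section (fun x => 0 : fib E x).
Proof.
move=> i k c; rewrite (_ : _ \o _ = fun=> 0); first exact: smooth_on_cst.
by apply/funext => y /=; rewrite linear0.
Qed.
Definition gamma0 : Gamma E := MkGamma gamma0_smooth (fun _ _ => erefl).

Fact gammaD_smooth psi eta : smooth_section (fun x => psi x + eta x).
Proof.
move=> i k c; have sp := gfun_smooth psi; have se := gfun_smooth eta.
have := smooth_onD (sp i k c) (se i k c).
by congr smooth_on; apply/funext => y /=; rewrite linearD.
Qed.
Fact gammaD_out psi eta x : ~ S x -> psi x + eta x = 0.
Proof. by move=> nSx; rewrite !gfun_out// addr0. Qed.
Definition gammaD psi eta : Gamma E :=
  MkGamma (@gammaD_smooth psi eta) (@gammaD_out psi eta).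

Fact gammaZ_smooth (a : R) psi : smooth_section (fun x => a *: psi x).
Proof.
move=> i k c; have sp := gfun_smooth psi.
have := smooth_onM (smooth_on_cst (D := _) a) (sp i k c).
by congr smooth_on; apply/funext => y /=; rewrite linearZ.
Qed.
Fact gammaZ_out (a : R) psi x : ~ S x -> a *: psi x = 0.
Proof. by move=> nSx; rewrite gfun_out// scaler0. Qed.
Definition gammaZ (a : R) psi : Gamma E :=
  MkGamma (@gammaZ_smooth a psi) (@gammaZ_out a psi).

Fact gammaA : associative gammaD.
Proof. by move=> *; apply: gamma_eqP => x /=; rewrite addrA. Qed.
Fact gammaC : commutative gammaD.
Proof. by move=> *; apply: gamma_eqP => x /=; rewrite addrC. Qed.
Fact gamma0D : left_id gamma0 gammaD.
Proof. by move=> *; apply: gamma_eqP => x /=; rewrite add0r. Qed.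
Fact gammaND : left_inverse gamma0 (gammaZ (-1)) gammaD.
Proof.
by move=> *; apply: gamma_eqP => x /=; rewrite scaleN1r addNr.
Qed.
HB.instance Definition _ :=
  GRing.isZmodule.Build (Gamma E) gammaA gammaC gamma0D gammaND.

Fact gammaZA a b psi : gammaZ a (gammaZ b psi) = gammaZ (a * b) psi.
Proof. by apply: gamma_eqP => x /=; rewrite scalerA. Qed.
Fact gamma1Z : left_id 1 gammaZ.
Proof. by move=> *; apply: gamma_eqP => x /=; rewrite scale1r. Qed.
Fact gammaZDr : right_distributive gammaZ +%R.
Proof. by move=> *; apply: gamma_eqP => x /=; rewrite scalerDr. Qed.
Fact gammaZDl psi : {morph gammaZ^~ psi : a b / a + b}.
Proof. by move=> *; apply: gamma_eqP => x /=; rewrite scalerDl. Qed.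
HB.instance Definition _ := GRing.Zmodule_isLmodule.Build R (Gamma E)
  gammaZA gamma1Z gammaZDr gammaZDl.

End SectionModule.

Record smoothfun (R : realType) (n : nat) (M : mfd R n) := MkSmoothfun {
  sfun :> M -> R;
  sfunP : smooth_fun [set: M] sfun }.

Section Multiplication.
Context {R : realType} {n : nat} {M : mfd R n} {S : set M} {E : vbundle S}.

Fact fmul_smooth (f : smoothfun M) (psi : Gamma E) :
  smooth_section (fun x => f x *: psi x).
Proof.
move=> i k c; have sp := gfun_smooth psi.
have sf := smooth_funW (@subsetT _ (S `&` fdom i)) (sfunP f).
have := smooth_onM (sf c) (sp i k c).
by congr smooth_on; apply/funext => y /=; rewrite linearZ.
Qed.
Fact fmul_out (f : smoothfun M) (psi : Gamma E) x :
  ~ S x -> f x *: psi x = 0.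
Proof. by move=> nSx; rewrite gfun_out// scaler0. Qed.
Definition fmul (f : smoothfun M) (psi : Gamma E) : Gamma E :=
  MkGamma (@fmul_smooth f psi) (@fmul_out f psi).

Definition fpow (f : smoothfun M) (k : nat) (psi : Gamma E) : Gamma E :=
  iter k (fmul f) psi.

End Multiplication.

Definition L2 (R : realType) (n : nat) (M : riem_mfd R n)
    (E : vbundle [set: M]) (psi eta : Gamma E) : R :=
  \int[vol M]_(x in [set: M]) fmetric (psi x) (eta x).

Definition L2bd (R : realType) (n : nat) (M : riem_mfd R n)
    (J : vbundle (bd M)) (psi eta : Gamma J) : R :=
  \int[bvol M]_(x in bd M) fmetric (psi x) (eta x).

Section ZeroBundle.
Context {R : realType} {n : nat} (M : mfd R n) (S : set M).

Fact zero_basis (i : unit) (x : M) : S x -> setT x ->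
  basis_of (fullv : {vspace 'rV[R]_0}) [tuple].
Proof.
move=> _ _; suff -> : fullv = 0%VS :> {vspace 'rV[R]_0} by exact: nil_basis.
by apply/eqP; rewrite -dimv_eq0 dimvf dim_matrix.
Qed.
Fact zero_frame_smooth (i j : unit) (k l : 'I_0) (f : M -> R) :
  smooth_fun (S `&` (setT `&` setT)) f.
Proof. by case: k. Qed.
Fact zero_metric_smooth (i : unit) (k l : 'I_0) (f : M -> R) :
  smooth_fun (S `&` setT) f.
Proof. by case: k. Qed.
Fact zero_pos (x : M) (v : 'rV[R]_0) : S x -> v != 0 -> 0 < 0 :> R.
Proof. by rewrite thinmx0 eqxx. Qed.

Program Definition zero_bundle : vbundle S := @VBundle R n M S
  (fun=> 'rV[R]_0) unit (fun=> setT) (fun=> 0%N) (fun _ _ => [tuple])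
  (fun=> openT) _ zero_basis
  (fun i j k l => zero_frame_smooth i j k l _) (fun _ _ _ => 0) _ _ zero_pos
  (fun i k l => zero_metric_smooth i k l _).
Next Obligation. by exists tt. Qed.
Next Obligation. by []. Qed.
Next Obligation. by move=> * /=; rewrite mulr0 addr0. Qed.

End ZeroBundle.

(* Palais: T has order at most m if T(f^{m+1} psi)(p) = 0 whenever f(p) = 0.
   With S = M and S' = M this defines interior differential operators, with
   S = M and S' = bd M boundary differential operators. *)
Definition diff_op_le (R : realType) (n : nat) (M : mfd R n) (S S' : set M)
    (E : vbundle S) (F : vbundle S') (m : nat) (T : Gamma E -> Gamma F) : Prop :=
  forall (f : smoothfun M) p psi, S' p -> f p = 0 ->
    T (fpow f m.+1 psi) p = 0.

Definition diff_op (R : realType) (n : nat) (M : mfd R n) (S S' : set M)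
    (E : vbundle S) (F : vbundle S') (T : Gamma E -> Gamma F) : Prop :=
  exists m, diff_op_le m T.

(* ord(T) = m; the zero operator has order 0. *)
Definition has_order (R : realType) (n : nat) (M : mfd R n) (S S' : set M)
    (E : vbundle S) (F : vbundle S') (T : Gamma E -> Gamma F) (m : nat) : Prop :=
  diff_op_le m T /\ forall k, diff_op_le k T -> (m <= k)%N.

(* The covector df_p in the chart c. *)
Definition dfun (R : realType) (n : nat) (M : mfd R n) (c : mchart M)
    (f : M -> R) (p : M) : 'rV[R]_n.+1 :=
  \row_a partial (f \o cinv (m := M) c) a (cmap c p).

Definition cometric (R : realType) (n : nat) (M : riem_mfd R n) (c : mchart M)
    (p : M) (xi zeta : 'rV[R]_n.+1) : R :=
  (xi *m invmx (gram c p) *m zeta^T) 0 0.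

(* For f(p) = 0: the value at (p, df_p) of the m-th order principal symbol of
   T, applied to psi(p).  The factor i^m arising from the convention
   d/dx_j -> i xi_j is left out: it affects neither kernels nor images. *)
Definition symbol (R : realType) (n : nat) (M : mfd R n) (S S' : set M)
    (E : vbundle S) (F : vbundle S') (T : Gamma E -> Gamma F) (m : nat)
    (f : smoothfun M) (p : M) (psi : Gamma E) : fib F p :=
  (m`!%:R)^-1 *: T (fpow f m psi) p.

(* For f(p) = r(p) = 0: the coefficient of t^k in the polynomial
   t |-> symbol T m (f + t r) p psi. *)
Definition symbol_coef (R : realType) (n : nat) (M : mfd R n) (S S' : set M)
    (E : vbundle S) (F : vbundle S') (T : Gamma E -> Gamma F) (m : nat)
    (f r : smoothfun M) (p : M) (psi : Gamma E) (k : nat) : fib F p :=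
  ('C(m, k)%:R / m`!%:R) *: T (fpow f (m - k) (fpow r k psi)) p.

(* dr_p is the inward unit conormal at the boundary point p. *)
Definition unit_conormal (R : realType) (n : nat) (M : riem_mfd R n)
    (r : smoothfun M) (p : M) : Prop :=
  r p = 0 /\ forall c : mchart M, cdom c p ->
    [/\ forall a, dfun c r p 0 (lift ord0 a) = 0,
        0 < dfun c r p 0 ord0 &
        cometric c p (dfun c r p) (dfun c r p) = 1].

(* df_p is a nonzero covector orthogonal to the conormal dr_p, that is, a
   nonzero covector of the boundary. *)
Definition tangential (R : realType) (n : nat) (M : riem_mfd R n)
    (f r : smoothfun M) (p : M) : Prop :=
  f p = 0 /\ forall c : mchart M, cdom c p ->
    dfun c f p != 0 /\ cometric c p (dfun c f p) (dfun c r p) = 0.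

Definition bundle_morphism (R : realType) (n : nat) (M : mfd R n) (S : set M)
    (E F : vbundle S) (Phi : forall x, fib E x -> fib F x) : Prop :=
  (forall x, S x -> linear (Phi x)) /\
  forall psi : Gamma E, exists eta : Gamma F,
    forall x, S x -> eta x = Phi x (psi x).

(* B = B_0 (+) ... (+) B_r with respect to an isomorphism, with components Phi,
   of J with J_0 (+) ... (+) J_r, where B_j is a boundary differential operator
   of order j. *)
Definition boundary_sum (R : realType) (n : nat) (M : riem_mfd R n)
    (E : vbundle [set: M]) (J : vbundle (bd M)) (B : Gamma E -> Gamma J)
    (r : nat) (J_ : 'I_r.+1 -> vbundle (bd M))
    (B_ : forall j, {linear Gamma E -> Gamma (J_ j)}) : Prop :=
  exists Phi : forall j x, fib J x -> fib (J_ j) x,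
    [/\ forall j, bundle_morphism (Phi j),
        forall x, bd M x -> forall w : (forall j, fib (J_ j) x),
          exists! v, forall j, Phi j x v = w j,
        forall j psi x, bd M x -> B_ j psi x = Phi j x (B psi x) &
        forall j : 'I_r.+1, diff_op_le j (B_ j)].

(* The coefficient of the j-th normal derivative in B_j is the symbol of B_j
   at the conormal. *)
Definition normal_system (R : realType) (n : nat) (M : riem_mfd R n)
    (E : vbundle [set: M]) (J : vbundle (bd M)) (B : Gamma E -> Gamma J) : Prop :=
  exists (r : nat) (J_ : 'I_r.+1 -> vbundle (bd M))
    (B_ : forall j, {linear Gamma E -> Gamma (J_ j)}),
    boundary_sum B B_ /\
    forall (j : 'I_r.+1) (p : M) (rho : smoothfun M), bd M p -> unit_conormal rho p ->
      forall v : fib (J_ j) p, exists psi, symbol (B_ j) j rho p psi = v.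

(* The equation sigma_m(T)(p, df + dr D_s) u(s) = 0, D_s = -i d/ds, in the
   complexified fibre, for u = sum_l (a_l + i b_l) psi_l(p); real and imaginary
   parts are stated separately, and
   i^m t^k |-> i^m (-i d/ds)^k = i^(m-k) (d/ds)^k for k <= m. *)
Definition frozen_eq (R : realType) (n : nat) (M : mfd R n) (S S' : set M)
    (E : vbundle S) (F : vbundle S') (T : Gamma E -> Gamma F) (m : nat)
    (f r : smoothfun M) (p : M) (q : nat) (psi : 'I_q -> Gamma E)
    (a b : 'I_q -> R -> R) (s : R) : Prop :=
  let z l k : R[i] :=
    'i%C ^+ (m - k) * Complex (derive1n k (a l) s) (derive1n k (b l) s) in
  \sum_l \sum_(k < m.+1)
    complex.Re (z l k) *: symbol_coef T m f r p (psi l) k = 0 /\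
  \sum_l \sum_(k < m.+1)
    complex.Im (z l k) *: symbol_coef T m f r p (psi l) k = 0.

Definition smooth_decaying (R : realType) (a : R -> R) : Prop :=
  (forall k s, derivable (derive1n k a) s 1) /\ a s @[s --> +oo] --> 0.

Definition symbol_injective (R : realType) (n : nat) (M : riem_mfd R n)
    (E F1 F2 : vbundle [set: M]) (P1 : Gamma E -> Gamma F1)
    (P2 : Gamma E -> Gamma F2) (m1 m2 : nat) : Prop :=
  forall (p : M) (f : smoothfun M), f p = 0 ->
    (forall c, cdom c p -> dfun c f p != 0) ->
    forall psi : Gamma E,
      symbol P1 m1 f p psi = 0 -> symbol P2 m2 f p psi = 0 -> psi p = 0.

(* The only decaying solution on the half-line s >= 0 of the frozen interior
   equations with vanishing frozen boundary data is zero.  The unknown is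
   expanded in a basis psi_l(p) of the fibre. *)
Definition lopatinskii_injective (R : realType) (n : nat) (M : riem_mfd R n)
    (E F1 F2 : vbundle [set: M]) (P1 : Gamma E -> Gamma F1)
    (P2 : Gamma E -> Gamma F2) (m1 m2 : nat)
    (r : nat) (J_ : 'I_r.+1 -> vbundle (bd M))
    (B_ : forall j, {linear Gamma E -> Gamma (J_ j)}) : Prop :=
  forall (p : M) (f rho : smoothfun M) (q : nat) (psi : 'I_q -> Gamma E)
    (a b : 'I_q -> R -> R),
    bd M p -> unit_conormal rho p -> tangential f rho p ->
    basis_of fullv [tuple psi l p | l < q] ->
    (forall l, smooth_decaying (a l) /\ smooth_decaying (b l)) ->
    (forall s, 0 <= s -> frozen_eq P1 m1 f rho p psi a b s /\
                         frozen_eq P2 m2 f rho p psi a b s) ->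
    (forall j : 'I_r.+1, frozen_eq (B_ j) j f rho p psi a b 0) ->
    forall l s, 0 <= s -> a l s = 0 /\ b l s = 0.

Definition overdetermined_elliptic (R : realType) (n : nat) (M : riem_mfd R n)
    (E F1 F2 : vbundle [set: M]) (J : vbundle (bd M))
    (P1 : Gamma E -> Gamma F1) (P2 : Gamma E -> Gamma F2)
    (B : Gamma E -> Gamma J) : Prop :=
  exists m1 m2 : nat,
    [/\ has_order P1 m1, has_order P2 m2, symbol_injective P1 P2 m1 m2 &
        exists (r : nat) (J_ : 'I_r.+1 -> vbundle (bd M))
          (B_ : forall j, {linear Gamma E -> Gamma (J_ j)}),
          boundary_sum B B_ /\ lopatinskii_injective P1 P2 m1 m2 B_].

(* E_{alpha-1}, and the operators T_{alpha-1} with source or target there;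
   everything of index -1 is zero. *)
Definition prev_bundle (R : realType) (n : nat) (M : mfd R n) (S : set M)
    (E : nat -> vbundle S) (al : nat) : vbundle S :=
  if al is be.+1 then E be else zero_bundle S.

Definition op_to_prev (R : realType) (n : nat) (M : mfd R n) (S S' : set M)
    (E : nat -> vbundle S) (F : nat -> vbundle S')
    (T : forall al, {linear Gamma (E al.+1) -> Gamma (F al)}) (al : nat) :
    {linear Gamma (E al) -> Gamma (prev_bundle F al)} :=
  match al return {linear Gamma (E al) -> Gamma (prev_bundle F al)} with
  | 0 => \0
  | be.+1 => T be
  end.

Definition op_from_prev (R : realType) (n : nat) (M : mfd R n) (S : set M)
    (E : nat -> vbundle S)
    (T : forall al, {linear Gamma (E al) -> Gamma (E al.+1)}) (al : nat) :
    {linear Gamma (prev_bundle E al) -> Gamma (E al)} :=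
  match al return {linear Gamma (prev_bundle E al) -> Gamma (E al)} with
  | 0 => \0
  | be.+1 => T be
  end.

Definition green (R : realType) (n : nat) (M : riem_mfd R n)
    (E F : vbundle [set: M]) (J : vbundle (bd M))
    (A : Gamma E -> Gamma F) (As : Gamma F -> Gamma E)
    (B : Gamma E -> Gamma J) (Bs : Gamma F -> Gamma J) : Prop :=
  forall psi eta, L2 (A psi) eta = L2 psi (As eta) + L2bd (B psi) (Bs eta).

Definition elliptic_precomplex (R : realType) (n : nat) (M : riem_mfd R n)
    (E : nat -> vbundle [set: M]) (J : nat -> vbundle (bd M)) (m : nat -> nat)
    (A : forall al, {linear Gamma (E al) -> Gamma (E al.+1)})
    (As : forall al, {linear Gamma (E al.+1) -> Gamma (E al)})
    (B : forall al, {linear Gamma (E al) -> Gamma (J al)})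
    (Bs : forall al, {linear Gamma (E al.+1) -> Gamma (J al)}) : Prop :=
  forall al,
    [/\ normal_system (B al), normal_system (Bs al),
        diff_op_le (m al) (A al.+1 \o A al) &
        overdetermined_elliptic (A al) (op_to_prev As al) (op_to_prev Bs al)].

(* Continuity of a linear map for the C^oo topology, which on a compact base is
   the one defined by the seminorms sup |D psi|, D a differential operator. *)
Definition frechet_continuous (R : realType) (n : nat) (M : mfd R n)
    (S S' : set M) (E : vbundle S) (F : vbundle S')
    (T : Gamma E -> Gamma F) : Prop :=
  forall D : {linear Gamma F -> Gamma F}, diff_op D ->
    exists (q : nat) (D_ : 'I_q -> {linear Gamma E -> Gamma E}) (C : R),
      (forall i, diff_op (D_ i)) /\
      forall (psi : Gamma E) (K : R), 0 <= K ->
        (forall i x, S x ->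
          Num.sqrt (fmetric (D_ i psi x) (D_ i psi x)) <= K) ->
        forall x, S' x ->
          Num.sqrt (fmetric (D (T psi) x) (D (T psi) x)) <= C * K.

Definition Ker (V W : zmodType) (T : V -> W) : set V := [set v | T v = 0].

(* LA is the lifted complex of A, and LAs the formal adjoints of LA. *)
Definition lifted_complex (R : realType) (n : nat) (M : riem_mfd R n)
    (E : nat -> vbundle [set: M]) (J : nat -> vbundle (bd M))
    (A : forall al, {linear Gamma (E al) -> Gamma (E al.+1)})
    (B : forall al, {linear Gamma (E al) -> Gamma (J al)})
    (Bs : forall al, {linear Gamma (E al.+1) -> Gamma (J al)})
    (LA : forall al, {linear Gamma (E al) -> Gamma (E al.+1)})
    (LAs : forall al, {linear Gamma (E al.+1) -> Gamma (E al)}) : Prop :=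
  (forall psi, LA 0 psi = A 0 psi) /\
  forall al,
    [/\ frechet_continuous (LA al), frechet_continuous (LAs al),
        green (LA al) (LAs al) (B al) (Bs al),
        forall psi, LA al.+1 (LA al psi) = 0 &
        forall psi, (Ker (LAs al) `&` Ker (Bs al)) psi ->
          LA al.+1 psi = A al.+1 psi].

(* P is the projection onto N in the L2-orthogonal direct sum
   Gamma(E) = I (+) N. *)
Definition orth_projection (R : realType) (n : nat) (M : riem_mfd R n)
    (E : vbundle [set: M]) (I N : set (Gamma E)) (P : Gamma E -> Gamma E) :
    Prop :=
  (forall phi chi, I phi -> N chi -> L2 phi chi = 0) /\
  forall psi, N (P psi) /\ I (psi - P psi).

(* Main.v *)
Require Import Defs.
From mathcomp Require Import all_boot all_order all_algebra.
From mathcomp Require Import all_classical all_reals all_analysis.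
From mathcomp Require Import measurable_realfun.
From mathcomp.real_closed Require Import polyrcf.

(** The component psi - P psi lies in the image of the preceding lifted operator,
    which the lifted A_alpha kills by the complex property, while on the other
    component P psi the lift coincides with A_alpha.  This is the first identity.
    On ker B_alpha^* the boundary terms of both Green formulae disappear, so that
    for eta there and all psi,
      <psi, LA* eta> = <LA psi, eta> = <A (P psi), eta> = <P psi, A* eta>
                     = <psi, P (A* eta)>,
    since an orthogonal projection is symmetric [orth_projection_sym].  The L2
    product separates smooth sections [L2_separates], which gives the second
    identity.  The third one follows: on ker B_alpha^* the two adjoint
    conditions agree, and where they hold the lift of A_(alpha+1) is
    A_(alpha+1) itself.

    What takes work is that the integral of the fibre metric really is an inner
    product.  Bilinearity needs integrability: the fibre product of two smooth
    sections is continuous [fmetric_cvg], hence bounded on the compact M.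
    Definiteness needs nonempty open sets to have positive volume [vol_gt0].  In
    a chart the volume is an iterated integral of the density sqrt(det g), which
    is positive [det_posdef_gt0] and continuous, hence bounded below near a
    point; and the image of a neighbourhood of that point contains a small cube
    [chart_box], also at the boundary, where the cube is placed on the inner
    side.  The integrands of the iterated integral are bounded below by their
    value on that cube, which avoids discussing their measurability
    [lebesgue_int_ge_box]. *)

Set Implicit Arguments.
Unset Strict Implicit.
Unset Printing Implicit Defensive.

Import Order.TTheory GRing.Theory Num.Theory numFieldNormedType.Exports.
Local Open Scope classical_set_scope.
Local Open Scope ring_scope.

(** * Linear algebra and iterated integrals *)

(** The characteristic polynomial of - G has no root t >= 0, as an eigenvector
    would make the quadratic form nonpositive; being monic, it is positive at 0. *)
Lemma det_posdef_gt0 (R : rcfType) (n : nat) (G : 'M[R]_n) :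
  (forall v : 'rV[R]_n, v != 0 -> 0 < (v *m G *m v^T) 0 0) -> 0 < \det G.
Proof.
move=> posG; pose p := char_poly (- G).
have noroot_p : {in `[0, +oo[, forall t, ~~ root p t}.
  move=> t; rewrite in_itv/= andbT => t0; apply/negP.
  rewrite -eigenvalue_root_char => /eigenvalueP[v vG v0].
  have := posG v v0; rewrite -[G]opprK mulmxN vG mulNmx -scalemxAl !mxE.
  rewrite oppr_gt0 ltNge mulr_ge0// sumr_ge0// => i _.
  by rewrite mxE -expr2 sqr_ge0.
have lc : lead_coef p = 1 := monicP (char_poly_monic _).
have : Num.sg p.[0] = polyrcf.sgp_pinfty p.
  by apply: (polyrcf.sgp_pinftyP noroot_p); rewrite in_itv/= lexx.
rewrite /polyrcf.sgp_pinfty lc sgr1 horner_coef0 char_poly_det -(scaleN1r G) detZ.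
by rewrite mulrA -expr2 sqrr_sign mul1r => /eqP; rewrite sgr_cp0.
Qed.

Lemma det_cvg (R : realType) (T : topologicalType) (n : nat)
    (G : T -> 'M[R]_n) (x : T) :
  (forall i j, G z i j @[z --> x] --> G x i j) ->
  \det (G z) @[z --> x] --> \det (G x).
Proof.
move=> cG; rewrite /determinant; apply: cvg_big => [|s _]; first exact: add_continuous.
apply: cvgM; first exact: cvg_cst.
apply: cvg_big => [|i _]; last exact: cG.
exact: mul_continuous.
Qed.

(** A Chebyshev-type bound.  The integral of a nonnegative function is a supremum
    over simple functions, hence monotone even where g is not measurable; this is
    why g, which will be an inner integral, is arbitrary. *)
Lemma le_integral_of_le_on d (T : measurableType d) (R : realType)
    (mu : {measure set T -> \bar R}) (D : set T) (c : R) (g : T -> \bar R) :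
  measurable D -> 0 <= c -> (forall x, 0 <= g x)%E ->
  (forall x, D x -> c%:E <= g x)%E ->
  (c%:E * mu D <= \int[mu]_x g x)%E.
Proof.
move=> mD c0 g0 cg.
have le_g x : (((c * \1_D x)%:E) <= g x)%E.
  rewrite indicE; case: (boolP (x \in D)) => [/set_mem Dx|_].
    by rewrite mulr1 cg.
  by rewrite mulr0 g0.
have -> : (c%:E * mu D = \int[mu]_x (c * \1_D x)%:E)%E.
  under eq_integral do rewrite EFinM.
  rewrite ge0_integralZl//.
  - by rewrite integral_indic// setIT.
  - exact/measurable_EFinP/measurable_indic.
have h0 x : (0 <= (c * \1_D x)%:E)%E by rewrite lee_fin mulr_ge0.
rewrite !ge0_integralTE//; apply: ereal_sup_le => _ [h hg <-].
by exists h => // x; exact: le_trans (hg x) (le_g x).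
Qed.

Lemma lebesgue_int_ge0 (R : realType) (n : nat) (f : 'rV[R]_n -> \bar R) :
  (forall y, 0 <= f y)%E -> (0 <= lebesgue_int f)%E.
Proof.
elim: n f => [|n IH] f f0 //=.
by apply: integral_ge0 => x _; exact: IH.
Qed.

(** Induction on n: on the first edge of the cube, the inner integral is at least
    c * r ^+ n. *)
Lemma lebesgue_int_ge_box (R : realType) (n : nat) (f : 'rV[R]_n -> \bar R)
    (a : 'rV[R]_n) (r c : R) :
  0 <= r -> 0 <= c -> (forall y, 0 <= f y)%E ->
  (forall y : 'rV[R]_n, (forall i, a 0 i <= y 0 i <= a 0 i + r) -> (c%:E <= f y)%E) ->
  ((c * r ^+ n)%:E <= lebesgue_int f)%E.
Proof.
move=> r0 c0; elim: n f a => [|n IH] f a f0 cf /=.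
  by rewrite mulr1; apply: cf => -[].
pose a' : 'rV[R]_n := \row_i a 0 (rshift 1 i).
pose I := `[a 0 ord0, a 0 ord0 + r]%classic.
have lI : lebesgue_measure (I : set R) = r%:E.
  rewrite /I lebesgue_measure_itv/= lte_fin ltrDl.
  case: ltP => [_|r0']; first by rewrite -EFinB addrC addKr.
  by congr EFin; apply/eqP; rewrite eq_le r0 r0'.
rewrite exprSr mulrA EFinM -lI; apply: le_integral_of_le_on => //.
- exact: measurable_itv.
- by rewrite mulr_ge0// exprn_ge0.
- by move=> x; apply: lebesgue_int_ge0 => y.
move=> x; rewrite /I /= in_itv/= => xa.
apply: (IH _ a') => [y|y ya']; first exact: f0.
apply: cf => i; case: (@split_ordP 1 n i) => j ->.
  have -> : lshift n j = ord0 :> 'I_n.+1 by rewrite ord1; exact/val_inj.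
  rewrite [X in _ <= X <= _](_ : _ = x)//.
  have := row_mxEl (x%:M : 'M[R]_1) y 0 ord0; rewrite [RHS]mxE mulr1n => e; rewrite -[RHS]e.
  by congr (row_mx _ _ _ _); apply: val_inj.
rewrite [X in _ <= X <= _](row_mxEr (x%:M : 'M[R]_1) y 0 j).
by have := ya' j; rewrite mxE.
Qed.

(** * Continuity of smooth sections *)

Lemma cmap_cvg (R : realType) (n : nat) (M : mfd R n) (c : mchart M) (x : M) :
  cdom c x -> cmap c z @[z --> x] --> cmap c x.
Proof.
move=> cx; have := @cmap_continuous R n M c.
by rewrite continuous_open_subspace; [apply; exact/mem_set|exact: cdom_open].
Qed.

(** Near x, f is a smooth function of the coordinates given by any chart at x. *)
Lemma smooth_fun_cvg (R : realType) (n : nat) (M : mfd R n) (D : set M)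
    (f : M -> R) (x : M) :
  open D -> smooth_fun D f -> D x -> f z @[z --> x] --> f x.
Proof.
move=> oD sf Dx; have [c cx] := cdom_cover x.
have [|g [sg fg]] := sf c (cmap c x); first by exists x.
have [cg _] := sg 0%N.
have gc : g (cmap c z) @[z --> x] --> g (cmap c x).
  exact: (cvg_comp _ _ (cmap_cvg cx) (cg _)).
have fgx z : (D `&` cdom c) z ->
    (cmap c @` (D `&` cdom c)) (cmap c z) by move=> ?; exists z.
have /(_ (fgx x (conj Dx cx))) /= := nbhs_singleton fg.
rewrite cmapK// => ->; apply: cvg_trans gc.
apply: near_eq_cvg.
have nD : nbhs x (D `&` cdom c).
  by apply: filterI; apply: open_nbhs_nbhs; split=> //; exact: cdom_open.
have nfg := cmap_cvg cx fg.
apply: filterS2 nD nfg => z Dz /= fgz.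
by rewrite -(fgz (fgx z Dz)) cmapK//; case: Dz.
Qed.

Section Metric.
Context {R : realType} {n : nat} {M : mfd R n} {S : set M} (E : vbundle S).
Implicit Types (x : M).

Lemma fmetric0l x (w : fib E x) : S x -> fmetric 0 w = 0.
Proof.
move=> Sx; apply: (addrI (fmetric 0 w)); rewrite addr0.
by have := fmetric_linear 1 0 0 w Sx; rewrite scaler0 addr0 mul1r => <-.
Qed.

Lemma fmetric0r x (w : fib E x) : S x -> fmetric w 0 = 0.
Proof. by move=> Sx; rewrite fmetric_sym// fmetric0l. Qed.

Lemma fmetric_suml x (w : fib E x) (q : nat) (a : 'I_q -> R)
    (e : 'I_q -> fib E x) :
  S x -> fmetric (\sum_k a k *: e k) w = \sum_k a k * fmetric (e k) w.
Proof.
move=> Sx; elim: q a e => [|q IH] a e; first by rewrite !big_ord0 fmetric0l.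
by rewrite !big_ord_recl fmetric_linear// IH.
Qed.

(** Smoothness is known only for coordinates in a frame and for the metric
    between frame vectors; this expresses the metric through them. *)
Lemma fmetric_frame (i : ftriv E) x (u v : fib E x) : S x -> fdom i x ->
  fmetric u v = \sum_k coord (frame i x) k u *
    \sum_l coord (frame i x) l v *
      fmetric (tnth (frame i x) l) (tnth (frame i x) k).
Proof.
move=> Sx ix; have /andP[/eqP span_f _] := frame_basis Sx ix.
have expand w : w = \sum_k coord (frame i x) k w *: tnth (frame i x) k.
  rewrite {1}(@coord_span _ _ _ (frame i x) w); last by rewrite span_f memvf.
  by apply: eq_bigr => k _; rewrite (tnth_nth 0).
rewrite {1}(expand u) fmetric_suml//; apply: eq_bigr => k _; congr (_ * _).
by rewrite fmetric_sym// {1}(expand v) fmetric_suml.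
Qed.

End Metric.

Lemma fmetric_cvg (R : realType) (n : nat) (M : mfd R n)
    (E : vbundle [set: M]) (psi eta : Gamma E) (x : M) :
  fmetric (psi z) (eta z) @[z --> x] --> fmetric (psi x) (eta x).
Proof.
have [i ix] := fdom_cover E (I : [set: M] x).
have oD : open ([set: M] `&` fdom i) by rewrite setTI; exact: fdom_open.
pose F z := \sum_k coord (frame i z) k (psi z) *
    \sum_l coord (frame i z) l (eta z) *
      fmetric (tnth (frame i z) l) (tnth (frame i z) k).
rewrite (fmetric_frame _ _ _ ix)// -/(F x).
suff cF : F z @[z --> x] --> F x.
  apply: cvg_trans cF; apply: near_eq_cvg.
  by apply: filterS (open_nbhs_nbhs (conj (fdom_open i) ix)) => z iz;
    rewrite (fmetric_frame _ _ _ iz).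
have Dx : ([set: M] `&` fdom i) x by [].
have spsi : smooth_section psi := gfun_smooth psi.
have seta : smooth_section eta := gfun_smooth eta.
have add_cont : continuous (fun z : R * R => z.1 + z.2) by exact: add_continuous.
apply: cvg_big => // k _; apply: cvgM.
  exact: (smooth_fun_cvg oD (spsi i k) Dx).
apply: cvg_big => // l _; apply: cvgM.
  exact: (smooth_fun_cvg oD (seta i l) Dx).
exact: (smooth_fun_cvg oD (fmetric_smooth l k) Dx).
Qed.

(** * Positivity of the volume *)

(** The chart is a homeomorphism onto a relatively open part of the half-space
    y_0 >= 0, which contains, with a point, every cube having that point as its
    lowest corner, provided that the cube is small.  Choosing the lowest corner
    treats interior and boundary points alike. *)
Lemma chart_box (R : realType) (n : nat) (M : mfd R n) (c : mchart M)
    (V : set M) (x : M) :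
  cdom c x -> nbhs x V ->
  exists2 r : R, 0 < r & forall y : 'rV[R]_n.+1,
    (forall i, cmap c x 0 i <= y 0 i <= cmap c x 0 i + r) ->
    exists2 z, (V `&` cdom c) z & cmap c z = y.
Proof.
move=> cx nV; have [W oW imW] := cmap_image c.
have imx : (cmap c @` cdom c) (cmap c x) by exists x.
have [Wx Hx] : (W `&` [set y | 0 <= y 0 0]) (cmap c x) by rewrite -imW.
have nW : nbhs (cmap c x) W by exact: open_nbhs_nbhs.
have /subspace_continuousP/(_ _ imx) := @cinv_continuous R n M c.
rewrite /from_subspace cmapK// => /(_ _ nV) /= nV'.
have : nbhs (cmap c x)
    (W `&` [set y | (cmap c @` cdom c) y -> V (cinv c y)]) by exact: filterI.
move=> /nbhs_ballP[e /= e0 eB].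
exists (e / 2) => [|y yB]; first by rewrite divr_gt0.
have [Wy Vy] : W y /\ ((cmap c @` cdom c) y -> V (cinv c y)).
  apply: eB; split=> // i j; rewrite ord1.
  have /andP[y1 y2] := yB j.
  rewrite -ball_normE/= distrC ger0_norm ?subr_ge0// ltrBlDl.
  by apply: le_lt_trans y2 _; rewrite ltrD2l ltr_pdivrMr// ltr_pMr// ltr1n.
have imy : (cmap c @` cdom c) y.
  rewrite imW; split=> //=; have /andP[y1 _] := yB 0.
  exact: le_trans Hx y1.
case: (imy) => z cz zy; exists z => //; split=> //.
by have := Vy imy; rewrite -zy cmapK.
Qed.

(** In a chart, the density is at least half its value at x near x, so that the
    volume is at least that half times the volume of a cube. *)
Lemma vol_gt0 (R : realType) (n : nat) (M : riem_mfd R n) (U : set M) (x : M) :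
  open U -> U x -> (0 < vol M U)%E.
Proof.
move=> oU Ux; have [c cx] := cdom_cover x.
pose s z := Num.sqrt (\det (gram c z)).
have s0 : 0 < s x.
  by rewrite sqrtr_gt0; apply: det_posdef_gt0 => v; exact: gram_pos.
have cs : s z @[z --> x] --> s x.
  have cdet : \det (gram c z) @[z --> x] --> \det (gram c x).
    apply: det_cvg => i j.
    have gs := smooth_fun_cvg (cdom_open c) (@gram_smooth R n M c i j) cx.
    exact: gs.
  by apply: (continuous_cvg _ _ cdet); exact: sqrt_continuous.
have shalf : s x / 2 < s x by rewrite ltr_pdivrMr// ltr_pMr// ltr1n.
pose N := U `&` cdom c `&` [set z | s x / 2 < s z].
have nN : nbhs x N.
  apply: filterI; last exact: cvgr_gt cs _ shalf.
  by apply: filterI; apply: open_nbhs_nbhs; split=> //; exact: cdom_open.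
pose V := interior N.
have mO (O : set M) : open O ->
    measurable (O : set (g_sigma_algebraType (@open M))).
  by move=> oO; exact: sub_sigma_algebra.
have oV : open V by exact: open_interior.
have VN : V `<=` N by exact: interior_subset.
have nV : nbhs x V by apply: open_nbhs_nbhs; split=> //.
have [r r0 box] := chart_box cx nV.
have VU : (vol M V <= vol M U)%E.
  by apply: le_measure; rewrite ?inE; [exact: mO|exact: mO|move=> z /VN[[]]].
apply: lt_le_trans VU; rewrite (@vol_chart R n M c); [|exact: mO|].
  have c0 : 0 < s x / 2 by rewrite divr_gt0.
  apply: lt_le_trans (lebesgue_int_ge_box (a := cmap c x) (r := r)
    (c := s x / 2) _ _ _ _) => //.
  - by rewrite lte_fin mulr_gt0// exprn_gt0.
  - exact: ltW.
  - exact: ltW.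
  move=> y /box[z [Vz cz] zy]; rewrite lee_fin indicE mem_set; last by exists z.
  by rewrite mul1r -zy cmapK// ltW//; have [_] := VN _ Vz.
by move=> z /VN[[]].
Qed.

(** * The inner product of smooth sections *)

Lemma continuous_integrable (R : realType) (n : nat) (M : riem_mfd R n)
    (f : M -> R) :
  continuous f -> (vol M).-integrable [set: M] (EFin \o f).
Proof.
move=> cf; apply: measurable_bounded_integrable => //.
- exact: (fin_num_fun_lty (fin_num_measure (vol M))).
- apply: (measurability _ (RGenOInfty.measurableE R)) => //.
  move=> /= _ [_ [t ->] <-]; rewrite setTI; apply: sub_sigma_algebra.
  by apply: open_comp => [z _|]; [exact: cf|exact: interval_open].
- have cK : compact (f @` [set: M]).
    by apply: continuous_compact (mcompact (m := M)); exact: continuous_subspaceT.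
  have [K [Kr fK]] := compact_bounded cK.
  by exists K; split=> // t Kt z _; apply: fK => //; exists z.
Qed.

Section L2Theory.
Context {R : realType} {n : nat} {M : riem_mfd R n} {E : vbundle [set: M]}.
Implicit Types psi eta chi : Gamma E.

Lemma L2_integrable psi eta :
  (vol M).-integrable [set: M] (EFin \o (fun x => fmetric (psi x) (eta x))).
Proof. by apply: continuous_integrable => x; exact: fmetric_cvg. Qed.

Lemma L2C psi eta : L2 psi eta = L2 eta psi.
Proof. by apply: eq_Rintegral => x _; rewrite fmetric_sym. Qed.

Lemma L2Dl psi eta chi : L2 (psi + eta) chi = L2 psi chi + L2 eta chi.
Proof.
rewrite /L2 -RintegralD//; [|exact: L2_integrable|exact: L2_integrable].
apply: eq_Rintegral => x _.
by rewrite -[fmetric (psi x) _]mul1r -fmetric_linear// scale1r.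
Qed.

Lemma L2Dr psi eta chi : L2 chi (psi + eta) = L2 chi psi + L2 chi eta.
Proof. by rewrite L2C L2Dl !(L2C chi). Qed.

(** If psi is nonzero at x, then |psi|^2 is bounded below by a positive constant
    on an open set, whose volume is positive. *)
Lemma L2_definite psi : L2 psi psi = 0 -> psi = 0.
Proof.
move=> psi0; apply: gamma_eqP => x; apply: contrapT => /eqP psix0.
pose h z := fmetric (psi z) (psi z).
have h_ge0 z : 0 <= h z.
  have [e|nz] := eqVneq (psi z) 0; last by apply: ltW; exact: fmetric_pos.
  by rewrite /h e fmetric0l.
have hx : 0 < h x by exact: fmetric_pos.
have hx2 : 0 < h x / 2 by rewrite divr_gt0.
have ch : continuous h by move=> z; exact: fmetric_cvg.
pose U := h @^-1` [set t | h x / 2 < t].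
have oU : open U by apply: open_comp => [z _|]; [exact: ch|exact: open_gt].
have Ux : U x by rewrite /U/= ltr_pdivrMr// ltr_pMr// ltr1n.
have mU : measurable (U : set (g_sigma_algebraType (@open M))).
  exact: sub_sigma_algebra.
have : ((h x / 2)%:E * vol M U <= \int[vol M]_z (EFin \o h) z)%E.
  apply: le_integral_of_le_on => //; first exact: ltW.
  by move=> z Uz; rewrite lee_fin; exact: ltW Uz.
have -> : (\int[vol M]_z (EFin \o h) z = 0)%E.
  rewrite -[LHS]fineK; first by congr EFin; exact: psi0.
  exact: integrable_fin_num (L2_integrable psi psi).
by apply/negP; rewrite -ltNge mule_gt0// (vol_gt0 oU Ux).
Qed.

Lemma L2_separates eta chi : (forall psi, L2 psi eta = L2 psi chi) -> eta = chi.
Proof.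
move=> e; apply: subr0_eq; apply: L2_definite.
by apply: (addIr (L2 (eta - chi) chi)); rewrite -L2Dr subrK e add0r.
Qed.

End L2Theory.

Lemma L2bd0r (R : realType) (n : nat) (M : riem_mfd R n) (J : vbundle (bd M))
    (psi : Gamma J) : L2bd psi 0 = 0.
Proof.
rewrite /L2bd; under eq_Rintegral => x /set_mem bx do rewrite fmetric0r//.
by rewrite /Rintegral integral0.
Qed.

(** Both sides are equal to L2 (P psi) (P eta), by orthogonality. *)
Lemma orth_projection_sym (R : realType) (n : nat) (M : riem_mfd R n)
    (E : vbundle [set: M]) (V W : set (Gamma E)) (P : Gamma E -> Gamma E)
    (psi eta : Gamma E) :
  orth_projection V W P -> L2 (P psi) eta = L2 psi (P eta).
Proof.
move=> [VW dec]; have [Wpsi Vpsi] := dec psi; have [Weta Veta] := dec eta.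
rewrite -[in LHS](subrK (P eta) eta) L2Dr (L2C (P psi)) (VW _ _ Veta Wpsi) add0r.
by rewrite -[in RHS](subrK (P psi) psi) L2Dl (VW _ _ Vpsi Weta) add0r.
Qed.

(** * The lifted complex *)

Theorem theorem2p4 (R : realType) (n : nat) (M : riem_mfd R n)
    (E : nat -> vbundle [set: M]) (J : nat -> vbundle (bd M)) (m : nat -> nat)
    (A : forall al, {linear Gamma (E al) -> Gamma (E al.+1)})
    (As : forall al, {linear Gamma (E al.+1) -> Gamma (E al)})
    (B : forall al, {linear Gamma (E al) -> Gamma (J al)})
    (Bs : forall al, {linear Gamma (E al.+1) -> Gamma (J al)})
    (hA : forall al, has_order (A al) (m al))
    (hAs : forall al, diff_op (As al))
    (hgreen : forall al, green (A al) (As al) (B al) (Bs al))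
    (hell : elliptic_precomplex m A As B Bs)
    (LA : forall al, {linear Gamma (E al) -> Gamma (E al.+1)})
    (LAs : forall al, {linear Gamma (E al.+1) -> Gamma (E al)})
    (hLA : lifted_complex A B Bs LA LAs)
    (* P al is the projection of index al - 1 *)
    (P : forall al, Gamma (E al) -> Gamma (E al))
    (hP : forall al,
      orth_projection (range (op_from_prev LA al))
        (Ker (op_to_prev LAs al) `&` Ker (op_to_prev Bs al)) (P al)) :
  forall al,
    [/\ forall psi, LA al psi = A al (P al psi),
        forall eta, Ker (Bs al) eta -> LAs al eta = P al (As al eta) &
        Ker (LA al.+1) `&` Ker (LAs al) `&` Ker (Bs al) =
        Ker (A al.+1) `&` Ker (P al \o As al) `&` Ker (Bs al)].
Proof.
have [LA0 LAS] := hLA => al.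
have lift psi : LA al psi = A al (P al psi).
  case: al psi => [|be] psi.
    (* The image of the operator of index -1 is zero, so that P 0 = id. *)
    have [_ /(_ psi)[_ [chi _ e]]] := hP 0%N.
    by rewrite LA0 -[in LHS](subrK (P 0%N psi) psi) -e/= add0r.
  have [_ /(_ psi)[Npsi [chi _ e]]] := hP be.+1.
  have [_ _ _ LALA LAker] := LAS be.
  by rewrite -LAker// -[in LHS](subrK (P be.+1 psi) psi) -e linearD/= LALA add0r.
have adj eta : Ker (Bs al) eta -> LAs al eta = P al (As al eta).
  move=> Bs0; apply: L2_separates => psi.
  have [_ _ LAgreen _ _] := LAS al.
  have := LAgreen psi eta; rewrite Bs0 L2bd0r addr0 => <-.
  rewrite lift hgreen Bs0 L2bd0r addr0.
  exact: orth_projection_sym (hP al).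
split=> //; have [_ _ _ _ LAker] := LAS al.
apply/seteqP; split=> eta [[LAeta adjeta] Bseta]; split=> //.
  split; last by rewrite /Ker/= -adj.
  by rewrite /Ker/= -LAker.
have LAs0 : LAs al eta = 0 by rewrite adj.
by split=> //; rewrite /Ker/= LAker.
Qed.
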